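(* Let $q$ be a prime power and $\ell$ a positive integer, let $g$ be a primitive element of $\mathbb F_{q^2}$, and let $Q:\mathbb F_{q^2}^{2\ell}\to\mathbb F_{q^2}$ be a nonsingular elliptic quadratic form. Let $\Omega_0=\{x\in\mathbb F_{q^2}^{2\ell}: x\ne0,\ Q(x)=0\}$ and, for $0\le i\le q$, let $\Omega_{g^i}=\{x\in\mathbb F_{q^2}^{2\ell}: x\neq0,\ \mathrm{tr}_{q^2/q}(g^iQ(x))=0\}$, where $\mathrm{tr}_{q^2/q}$ is the trace from $\mathbb F_{q^2}$ to $\mathbb F_q$. Then the sets $\Omega_0$ and $\Omega_{g^i}\setminus\Omega_0$, $0\le i\le q$, are partial difference sets in the additive group of $\mathbb F_{q^2}^{2\ell}$, and the strongly regular (Cayley) graphs associated to them form a $(q+2)$-class amorphic association scheme on $\mathbb F_{q^2}^{2\ell}$.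
   Context: Quadratic forms. A quadratic form on an $\mathbb F$-vector space $V$ is a function $Q:V\to\mathbb F$ with $Q(\gamma v)=\gamma^2Q(v)$ for $\gamma\in\mathbb F$, $v\in V$, and such that $B(v_1,v_2)=Q(v_1+v_2)-Q(v_1)-Q(v_2)$ is bilinear. It is nonsingular if the only subspace $W$ with $Q$ vanishing on $W$ and $B(w,v)=0$ for all $w\in W$, $v\in V$ is zero. A nonsingular quadratic form on a space of even dimension $2\ell$ is elliptic if it is equivalent (under a linear change of variables) to $p(x_1,x_2)+x_3x_4+\cdots+x_{2\ell-1}x_{2\ell}$ with $p$ an irreducible quadratic form in two indeterminates. Partial difference sets. A $k$-subset $D$ of a finite group $G$ of order $v$ (written additively) is a $(v,k,\lambda,\mu)$-partial difference set if the list of differences $d_1-d_2$, $d_1,d_2\in D$, $d_1\ne d_2$, contains each nonidentity element of $D$ exactly $\lambda$ times and each nonidentity element of $G\setminus D$ exactly $\mu$ times. The Cayley graph associated to $D$ has vertex set $G$, with $x,y$ adjacent iff $x-y\in D$. Association schemes. A (symmetric) association scheme with $d$ classes on a finite set $X$ is a partition of $X\times X$ into relations $R_0,\dots,R_d$ with $R_0$ the diagonal, each $R_i$ ($i\ge1$) symmetric, and such that for all $i,j,k\in\{0,\dots,d\}$ there is an integer $p_{ij}^k$ with $|\{z\in X:(x,z)\in R_i,(z,y)\in R_j\}|=p_{ij}^k$ for all $(x,y)\in R_k$. (A part of the partition is allowed to be empty.) Graphs $G_1,\dots,G_d$ on $X$ form an association scheme if the diagonal together with their adjacency relations is one. A fusion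 is obtained by taking unions of the classes $R_1,\dots,R_d$ according to a partition of $\{1,\dots,d\}$; the scheme is amorphic if every fusion is also an association scheme. *)

(* Defs.v *)
From HB Require Import structures.
From mathcomp Require Import all_boot all_order all_fingroup all_algebra.
From mathcomp Require Import mpoly.

Set Implicit Arguments.
Unset Strict Implicit.
Unset Printing Implicit Defensive.

Import GRing.Theory.
Local Open Scope ring_scope.

Definition prime_power (q : nat) : Prop :=
  exists p n : nat, [/\ prime p, (0 < n)%N & q = (p ^ n)%N].

Section QuadraticForms.

Variables (F : fieldType) (V : vectType F).
Implicit Type Q : V -> F.

Definition polar Q (v w : V) : F := Q (v + w) - Q v - Q w.

Definition quadratic_form Q : Prop :=
  (forall (c : F) (v : V), Q (c *: v) = c ^+ 2 * Q v)
  /\ bilinear_for *%R *%R (polar Q).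

Definition nonsingular Q : Prop :=
  forall W : {vspace V},
    (forall w, w \in W -> Q w = 0 /\ forall v, polar Q w v = 0) ->
    W = 0%VS.

End QuadraticForms.

Definition irreducible_elt (R : idomainType) (p : R) : Prop :=
  p \isn't a GRing.unit
  /\ forall a b : R, p = a * b -> a \is a GRing.unit \/ b \is a GRing.unit.

(* Coordinates are numbered from 0; [vcoord x k] is 0 when [k] is out of
   range. *)
Definition vcoord (F : fieldType) n (x : 'rV[F]_n) (k : nat) : F :=
  if insub k is Some i then x ord0 i else 0.

Definition elliptic_model (F : fieldType) (l : nat) (p : {mpoly F[2]})
    (x : 'rV[F]_(2 * l)) : F :=
  p.@[fun i : 'I_2 => vcoord x i]
  + \sum_(1 <= j < l) vcoord x (2 * j)%N * vcoord x (2 * j).+1.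

Definition elliptic (F : fieldType) (l : nat) (Q : 'rV[F]_(2 * l) -> F) :
    Prop :=
  exists (p : {mpoly F[2]}) (A : 'M[F]_(2 * l)),
    [/\ p \is 2.-homog, irreducible_elt p, A \in unitmx
      & forall x, Q x = elliptic_model p (x *m A)].

Section PartialDifferenceSets.

Variable G : finZmodType.

Definition partial_difference_set (D : {set G}) (v k lam mu : nat) : Prop :=
  [/\ #|G| = v, #|D| = k
    & forall x : G, x != 0 ->
        #|[set d : G * G | [&& d.1 \in D, d.2 \in D, d.1 != d.2
                             & d.1 - d.2 == x]]|
        = if x \in D then lam else mu].

Definition cayley (D : {set G}) : rel G := fun x y => x - y \in D.

End PartialDifferenceSets.

Section Schemes.

Variable X : finType.

(* Empty and complete graphs are not excluded. *)
Definition strongly_regular (e : rel X) (v k lam mu : nat) : Prop :=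
  [/\ ssrbool.symmetric e, irreflexive e, #|X| = v,
      forall x, #|[set y | e x y]| = k
    & forall x y, x != y ->
        #|[set z | e x z && e z y]| = if e x y then lam else mu].

Definition assoc_scheme d (R : 'I_d.+1 -> rel X) : Prop :=
  [/\ forall x y, exists! i, R i x y,
      forall x y, R ord0 x y = (x == y),
      forall i, ssrbool.symmetric (R i)
    & forall i j k, exists p : nat, forall x y, R k x y ->
        #|[set z | R i x z && R j z y]| = p].

Definition graph_relations d (E : 'I_d -> rel X) : 'I_d.+1 -> rel X :=
  fun k => if unlift ord0 k is Some i then E i else eq_op.

End Schemes.

(* [P] is a partition of the index set of the nondiagonal classes, so that
   class [lift ord0 i] of [R] is indexed by [i : 'I_d]; the parts are numbered
   by [enum_val]. *)
Definition fusion (X : finType) d (R : 'I_d.+1 -> rel X) (P : {set {set 'I_d}}) :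
    'I_#|P|.+1 -> rel X :=
  fun k => if unlift ord0 k is Some j
           then fun x y => [exists i in enum_val j, R (lift ord0 i) x y]
           else R ord0.

Arguments fusion {X d} R P.

Definition amorphic (X : finType) d (R : 'I_d.+1 -> rel X) : Prop :=
  assoc_scheme R
  /\ forall P : {set {set 'I_d}}, partition P [set: 'I_d] ->
       assoc_scheme (fusion R P).

Section OmegaSets.

Variables (F : finFieldType) (q l : nat) (g : F) (Q : 'rV[F]_(2 * l) -> F).

(* When #|F| = q ^ 2, the conjugates of [a] over the subfield of order q are
   [a] and [a ^+ q]. *)
Definition trace_to_Fq (a : F) : F := a + a ^+ q.

Definition Omega0 : {set 'rV[F]_(2 * l)} :=
  [set x | (x != 0) && (Q x == 0)].

Definition Omega (i : nat) : {set 'rV[F]_(2 * l)} :=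
  [set x | (x != 0) && (trace_to_Fq (g ^+ i * Q x) == 0)].

Definition Omega_class : 'I_q.+2 -> {set 'rV[F]_(2 * l)} :=
  fun k => if unlift ord0 k is Some i then Omega i :\: Omega0 else Omega0.

End OmegaSets.

(* Main.v *)
Require Import Defs.
From HB Require Import structures.
From mathcomp Require Import all_boot all_order all_fingroup all_algebra.
From mathcomp Require Import all_field.
From mathcomp Require Import mpoly.
From mathcomp Require Import ring.

(** Write [r = q ^ 2] for the size of the field, [n = r ^ l], so that the space
    has [n ^ 2] vectors, and [J] for the all-one matrix.

    An elliptic form takes every nonzero value on equally many vectors and the
    value [0] on [n] vectors fewer ([elliptic_level]).  Over the subfield with
    [q] elements the forms [tr (g ^ i * Q x)] have the same property, with the
    same [n] ([level_tauQ]).  Let [Z] be the adjacency matrix, diagonal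
    included, of the relation [T (x - y) = 0], where [T] is one of these
    [q + 2] forms and [k] is the size of the field in which it takes its
    values.  An entry of [Z ^ 2] counts the [z] with [T z = T (w - z) = 0].  To
    compute it, one counts the zeros of every member [t * T z + s * T (w - z)]
    of the pencil and completes the square: a translation of [z] turns each
    member into a multiple of [T] plus a constant, apart from the one with
    [t + s = 0], which is affine.  So [Z ^ 2] is a combination of [Z],
    [1] and [J], and
    [Z = - n * P + (n / k) * 1 + (1 / k - 1 / n) * J] with a symmetric
    idempotent [P] that annihilates [J] ([zero_idem_sym_idem]).

    Let [e] be the idempotent of [Q] and [f i] that of [tr (g ^ i * Q x)].  A
    nonzero value of [Q] is killed by exactly one of the [q + 1] maps
    [tr (g ^ i * _)], which gives [\sum_i f i = 1 - J / n ^ 2 + q * e].  Since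
    the trace of a product of two symmetric idempotents is a sum of squares,
    this identity alone forces [e * f i = e] and makes [e] and the [f i - e]
    pairwise orthogonal ([sym_idem_sunflower]).  The adjacency matrices of the
    graphs in the theorem are [- n] times these orthogonal idempotents up to
    combinations of [1] and [J].  The same holds, with sums of the idempotents,
    for every union of classes, so that the product of the matrices of two equal
    or disjoint unions stays in the span of the two matrices, [1] and [J]: every
    fusion is an association scheme ([amorphic_orthogonal]), and every class is
    strongly regular ([strongly_regular_orthogonal]). *)

Set Implicit Arguments.
Unset Strict Implicit.
Unset Printing Implicit Defensive.

Import Order.TTheory GRing.Theory Num.Theory.
Local Open Scope ring_scope.

(** * Symmetric idempotent matrices *)

Section SymmetricIdempotents.

Variables (R : realFieldType) (N : nat).
Implicit Types P Q : 'M[R]_N.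

Definition sym_idem P : Prop := P^T = P /\ P *m P = P.

(** [(P *m Q)^T = Q *m P] and the trace is cyclic, so that idempotency turns
    [\tr ((P *m Q) *m (P *m Q)^T)] into [\tr (P *m Q)]. *)
Lemma mxtrace_sym_idem P Q :
  sym_idem P -> sym_idem Q ->
  \tr (P *m Q) = \sum_i \sum_j (P *m Q) i j ^+ 2.
Proof.
move=> [tP PP] [tQ QQ].
have -> : \tr (P *m Q) = \tr ((P *m Q) *m (P *m Q)^T).
  rewrite trmx_mul tP tQ -mulmxA [Q *m (Q *m P)]mulmxA QQ.
  by rewrite [RHS]mxtrace_mulC -mulmxA PP mxtrace_mulC.
apply: eq_bigr => i _; rewrite mxE; apply: eq_bigr => j _.
by rewrite [X in _ * X]mxE expr2.
Qed.

(** Each trace is nonnegative, so a vanishing sum leaves every trace, hence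
    every entry of every product, equal to zero. *)
Lemma sym_idem_orthogonal (I : finType) (C : pred I) P (Q : I -> 'M[R]_N) :
  sym_idem P -> (forall i, C i -> sym_idem (Q i)) ->
  \sum_(i | C i) P *m Q i = 0 -> forall i, C i -> P *m Q i = 0.
Proof.
move=> sP sQ sum0.
have tr_ge0 i : C i -> 0 <= \tr (P *m Q i).
  move=> Ci; rewrite (mxtrace_sym_idem sP (sQ _ Ci)).
  by apply: sumr_ge0 => a _; apply: sumr_ge0 => b _; apply: sqr_ge0.
have : \sum_(i | C i) \tr (P *m Q i) = 0.
  by rewrite -raddf_sum sum0 raddf0.
move=> /eqP; rewrite psumr_eq0 // => /allP tr0 i Ci.
have := tr0 i (mem_index_enum i); rewrite Ci /= (mxtrace_sym_idem sP (sQ _ Ci)).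
rewrite psumr_eq0 => [/allP rows0|a _]; last first.
  by apply: sumr_ge0 => b _; apply: sqr_ge0.
apply/matrixP => a b; have := rows0 a (mem_index_enum a); rewrite /=.
rewrite psumr_eq0 => [/allP row0|c _]; last exact: sqr_ge0.
by have := row0 b (mem_index_enum b); rewrite /= sqrf_eq0 [RHS]mxE => /eqP.
Qed.

Lemma sym_idem_compl P : sym_idem P -> sym_idem (1%:M - P).
Proof.
case=> tP PP; split; first by rewrite linearB /= trmx1 tP.
by rewrite mulmxBl mul1mx mulmxBr mulmx1 PP subrr subr0.
Qed.

Lemma sym_idemB P Q : sym_idem P -> sym_idem Q -> Q *m P = Q ->
  sym_idem (P - Q) /\ Q *m (P - Q) = 0.
Proof.
move=> [tP PP] [tQ QQ] QP; split; last by rewrite mulmxBr QP QQ subrr.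
have PQ : P *m Q = Q by rewrite -{1}tP -{1}tQ -trmx_mul QP.
split; first by rewrite linearB /= tP tQ.
by rewrite mulmxBl !mulmxBr PP QQ PQ QP subrr subr0.
Qed.

End SymmetricIdempotents.

(** Each [e *m (1%:M - f i)] has nonnegative trace, and multiplying the sum of
    the [f i] by [e] shows that these traces add up to zero; so [e *m f i = e].
    Then the [f i - e] are symmetric idempotents whose sum acts on each of them
    as the identity, and the same argument makes them orthogonal. *)
Lemma sym_idem_sunflower (R : realFieldType) (N n : nat) (e Z : 'M[R]_N)
    (f : 'I_n.+1 -> 'M[R]_N) :
  sym_idem e -> (forall i, sym_idem (f i)) ->
  \sum_i f i = 1%:M - Z + n%:R *: e -> e *m Z = 0 -> (forall i, f i *m Z = 0) ->
  let P k := if unlift ord0 k is Some i then f i - e else e in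
  forall i j : 'I_n.+2, P i *m P j = if i == j then P i else 0.
Proof.
move=> se sf sum_f eZ fZ P.
have ef i : e *m f i = e.
  have sc j (_ : true) := sym_idem_compl (sf j).
  apply/eqP; rewrite eq_sym -subr_eq0 -{1}[e]mulmx1 -mulmxBr; apply/eqP.
  apply: (sym_idem_orthogonal se sc) => //=.
  rewrite -mulmx_sumr sumrB sum_f sumr_const card_ord mulmxBr mulmxDr mulmxBr.
  rewrite eZ -scalemxAr se.2 -scaler_nat -scalemxAr mulmx1 subr0.
  by rewrite -natr1 scalerDl scale1r [e + _]addrC subrr.
have sp i := (sym_idemB (sf i) se (ef i)).1.
have ep i := (sym_idemB (sf i) se (ef i)).2.
have pe i : (f i - e) *m e = 0.
  by rewrite -(sp i).1 -{2}se.1 -trmx_mul ep trmx0.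
have pp i j : i != j -> (f i - e) *m (f j - e) = 0.
  move=> ij; have spj k (_ : k != i) := sp k.
  apply: (sym_idem_orthogonal (sp i) spj) => /=; last by rewrite eq_sym.
  rewrite -mulmx_sumr; set S := \sum_(_ | _) _.
  have -> : S = 1%:M - Z - e - (f i - e).
    apply: (addrI (f i - e)); rewrite [RHS]addrC subrK /S.
    rewrite -(bigD1 (P := predT) (F := fun k => f k - e) i) //= sumrB sum_f.
    by rewrite sumr_const card_ord scaler_nat mulrSr opprD addrA addrK.
  have pZ : (f i - e) *m Z = 0 by rewrite mulmxBl fZ eZ subrr.
  by rewrite mulmxBr (sp i).2 mulmxBr pe mulmxBr mulmx1 pZ !subr0 subrr.
move=> i j; rewrite /P; case: (unliftP ord0 i) => [i'|] ->;
  case: (unliftP ord0 j) => [j'|] ->; rewrite ?(inj_eq lift_inj) //.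
- by have [<-|/pp] := eqVneq i' j'; [rewrite (sp i').2|].
- by rewrite eqxx se.2.
Qed.

(** * Amorphic schemes from orthogonal idempotents *)

Section RelationMatrices.

Variable X : finType.
Implicit Type e : rel X.

Definition relmx e : 'M[rat]_#|X| :=
  \matrix_(i, j) (e (enum_val i) (enum_val j))%:R.

Lemma relmxE e x y : relmx e (enum_rank x) (enum_rank y) = (e x y)%:R.
Proof. by rewrite mxE !enum_rankK. Qed.

Lemma relmx_mulE e f x y :
  (relmx e *m relmx f) (enum_rank x) (enum_rank y)
  = #|[set z | e x z && f z y]|%:R.
Proof.
rewrite mxE (reindex _ (onW_bij _ (@enum_rank_bij X))) /=.
rewrite -[X in _ = X%:R]sum1_card natr_sum [RHS]big_mkcond /=.
by apply: eq_bigr => z _; rewrite !relmxE inE -natrM mulnb; case: andb.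
Qed.

Lemma relmx_eq : relmx eq_op = 1%:M.
Proof. by apply/matrixP => i j; rewrite !mxE (inj_eq enum_val_inj). Qed.

Lemma relmxP (A B : 'M[rat]_#|X|) :
  (forall x y, A (enum_rank x) (enum_rank y) = B (enum_rank x) (enum_rank y)) ->
  A = B.
Proof.
by move=> AB; apply/matrixP => i j; rewrite -(enum_valK i) -(enum_valK j).
Qed.

Lemma relmx_sym e : ssrbool.symmetric e -> (relmx e)^T = relmx e.
Proof. by move=> se; apply/matrixP => i j; rewrite !mxE se. Qed.

End RelationMatrices.

Section Amorphic.

Variables (X : finType) (d : nat) (E : 'I_d -> rel X).
Variables (P : 'I_d -> 'M[rat]_#|X|) (c : rat) (a b : 'I_d -> rat).

Local Notation J := (const_mx 1 : 'M[rat]_#|X|).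

Hypothesis E_sym : forall i, ssrbool.symmetric (E i).
Hypothesis E_irr : forall i, irreflexive (E i).
Hypothesis E_cover : forall x y, x != y -> exists i, E i x y.
Hypothesis E_disj : forall i j x y, E i x y -> E j x y -> i = j.
Hypothesis relmxE_P :
  forall i, relmx (E i) = c *: P i + a i *: 1%:M + b i *: J.
Hypothesis P_orth : forall i j, P i *m P j = if i == j then P i else 0.
Hypothesis PJ0 : forall i, P i *m J = 0.
Hypothesis JP0 : forall i, J *m P i = 0.

Implicit Types S T : {set 'I_d}.

Definition union_rel (S : {set 'I_d}) : rel X :=
  fun x y => [exists i in S, E i x y].

Lemma union_rel1 i x y : union_rel [set i] x y = E i x y.
Proof.
by apply/exists_inP/idP => [[j /set1P->]|] // eixy; exists i; rewrite ?inE.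
Qed.

Lemma union_rel_sym S : ssrbool.symmetric (union_rel S).
Proof. by move=> x y; apply: eq_existsb => i; rewrite E_sym. Qed.

Lemma union_rel_irr S : irreflexive (union_rel S).
Proof. by move=> x; apply/exists_inP => -[i _]; rewrite E_irr. Qed.

Lemma union_rel_disj (S T : {set 'I_d}) x y :
  union_rel S x y -> union_rel T x y -> exists i, (i \in S) && (i \in T).
Proof.
move=> /exists_inP[i iS ei] /exists_inP[j jT ej].
by exists i; rewrite iS (E_disj ei ej).
Qed.

Let PS (S : {set 'I_d}) := \sum_(i in S) P i.
Let aS (S : {set 'I_d}) := \sum_(i in S) a i.
Let bS (S : {set 'I_d}) := \sum_(i in S) b i.

Lemma relmx_union S :
  relmx (union_rel S) = c *: PS S + aS S *: 1%:M + bS S *: J.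
Proof.
rewrite /PS /aS /bS scaler_sumr !scaler_suml -!big_split /=.
rewrite -(eq_bigr _ (fun i _ => relmxE_P i)); apply: relmxP => x y.
rewrite relmxE summxE (eq_bigr _ (fun i _ => relmxE (E i) x y)).
have [/exists_inP[i iS ei]|/exists_inPn none] := boolP (union_rel S x y).
  rewrite (bigD1 i) //= ei big1 ?addr0 // => j /andP[_].
  by apply: contraNeq; rewrite pnatr_eq0 eqb0 negbK => ej; rewrite (E_disj ej ei).
by rewrite big1 // => i /none /negbTE ->.
Qed.

(** Equal or disjoint index sets keep the product inside the span of the two
    factors, the identity and [J], because the idempotents multiply to [PS S]
    or to zero. *)
Lemma relmx_union_mul S T : S = T \/ [disjoint S & T] ->
  exists t0 t1 t2 t3 : rat, relmx (union_rel S) *m relmx (union_rel T)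
    = t0 *: relmx (union_rel S) + t1 *: relmx (union_rel T)
      + t2 *: 1%:M + t3 *: J.
Proof.
move=> ST.
have PJ U : PS U *m J = 0 by rewrite mulmx_suml big1.
have JP U : J *m PS U = 0 by rewrite mulmx_sumr big1.
have JJ : J *m J = #|X|%:R *: J.
  apply/matrixP => i j; rewrite !mxE (eq_bigr (fun=> 1)) => [|k _].
    by rewrite sumr_const card_ord mulr1.
  by rewrite !mxE mulr1.
have PP : exists s, PS S *m PS T = s *: PS S.
  case: ST => [<-|/pred0P dST]; [exists 1 | exists 0];
    rewrite ?scale1r ?scale0r mulmx_suml.
    apply: eq_bigr => i iS; rewrite mulmx_sumr (bigD1 i) //= P_orth eqxx.
    by rewrite big1 ?addr0 // => j /andP[_ ji]; rewrite P_orth eq_sym (negbTE ji).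
  apply: big1 => i iS; rewrite mulmx_sumr big1 // => j jT.
  by rewrite P_orth; case: eqP => // ij; have := dST i; rewrite /= {2}ij iS jT.
case: PP => s PP.
pose u0 := c * s + aS T; pose u1 := aS S.
exists u0, u1, (aS S * aS T - u0 * aS S - u1 * aS T),
  (bS S * aS T + aS S * bS T + bS S * bS T * #|X|%:R - u0 * bS S - u1 * bS T).
rewrite !relmx_union !mulmxDl !mulmxDr.
rewrite -!scalemxAl -!scalemxAr PP PJ JP JJ !mul1mx !mulmx1 !scaler0.
by apply/matrixP => i j; rewrite !mxE /u0 /u1; ring.
Qed.

(** Reading the matrix identity entrywise, the number of [z] depends on [x] and
    [y] only through three Booleans; [Num.truncn] merely turns the rational
    value back into the natural number that it is. *)
Lemma count_union_rel S T : S = T \/ [disjoint S & T] ->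
  exists t : bool -> bool -> bool -> nat, forall x y,
    #|[set z | union_rel S x z && union_rel T z y]|
    = t (union_rel S x y) (union_rel T x y) (x == y).
Proof.
move=> /relmx_union_mul[t0 [t1 [t2 [t3 tE]]]].
exists (fun p r s => Num.truncn (t0 * p%:R + t1 * r%:R + t2 * s%:R + t3)).
move=> x y; have := congr1 (fun A : 'M[rat]_#|X| => A (enum_rank x) (enum_rank y)) tE.
rewrite relmx_mulE -relmx_eq !mxE !enum_rankK mulr1.
by move=> <-; rewrite natrK.
Qed.

Section Family.

Variables (m : nat) (S : 'I_m -> {set 'I_d}) (U : 'I_m.+1 -> rel X).
Hypothesis S_disj : forall i j, i != j -> [disjoint S i & S j].
Hypothesis S_cover : forall k, exists i, k \in S i.
Hypothesis U0 : forall x y, U ord0 x y = (x == y).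
Hypothesis U_lift : forall i x y, U (lift ord0 i) x y = union_rel (S i) x y.

Let U_uniq i j x y : U i x y -> U j x y -> i = j.
Proof.
case: (unliftP ord0 i) => [i'|] ->; case: (unliftP ord0 j) => [j'|] ->;
  rewrite ?U_lift ?U0 //.
- move=> ui uj; congr lift; have [k /andP[ki kj]] := union_rel_disj ui uj.
  by apply/eqP; apply: contraLR ki => /S_disj/disjointFl ->.
- by move=> ui /eqP xy; rewrite xy union_rel_irr in ui.
- by move=> /eqP xy uj; rewrite xy union_rel_irr in uj.
Qed.

(** The scheme and its fusions are all given by a family of disjoint index sets,
    the classes themselves being given by singletons. *)
Lemma assoc_scheme_union : assoc_scheme U.
Proof.
split=> [x y|//|i|i j k].
- have [<-|] := eqVneq x y.
    by exists ord0; split=> [|j]; [rewrite U0 | apply: U_uniq; rewrite U0].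
  move=> /E_cover[k ek]; have [i ki] := S_cover k; exists (lift ord0 i).
  have ui : U (lift ord0 i) x y by rewrite U_lift; apply/exists_inP; exists k.
  by split=> // j; apply: U_uniq.
- move=> x y; case: (unliftP ord0 i) => [i'|] ->; rewrite !(U_lift, U0).
    exact: union_rel_sym.
  exact: eq_sym.
have UE i' x y : U k x y -> U i' x y = (i' == k).
  by move=> uk; apply/idP/eqP => [ui|->] //; apply: U_uniq ui uk.
(* A class composed with the diagonal gives back the class. *)
case: (unliftP ord0 i) => [i'|] ->; last first.
  exists (j == k) => x y uk; rewrite -(UE j x y uk) -[RHS]/(nat_of_bool _).
  rewrite (_ : [set z | _] = if U j x y then [set x] else set0).
    by case: (U j x y); rewrite ?cards1 ?cards0.
  apply/setP => z; rewrite !inE U0 (eq_sym x).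
  by have [->|zx] := eqVneq z x; case: (U j x y); rewrite ?inE ?eqxx // (negbTE zx).
case: (unliftP ord0 j) => [j'|] ->; last first.
  exists (lift ord0 i' == k) => x y uk.
  rewrite -(UE (lift ord0 i') x y uk).
  rewrite (_ : [set z | _] = if U (lift ord0 i') x y then [set y] else set0).
    by case: (U _ x y); rewrite ?cards1 ?cards0.
  apply/setP => z; rewrite !inE U0.
  by have [->|zy] := eqVneq z y; case: (U _ x y);
    rewrite ?inE ?eqxx ?andbT ?andbF // (negbTE zy).
have [|t tE] := @count_union_rel (S i') (S j').
  by have [->|/S_disj] := eqVneq i' j'; [left | right].
exists (t (lift ord0 i' == k) (lift ord0 j' == k) (ord0 == k)) => x y uk.
rewrite -(UE (lift ord0 i') x y uk) -(UE (lift ord0 j') x y uk).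
rewrite -(UE ord0 x y uk) U0 !U_lift -tE.
by apply: eq_card => z; rewrite !inE !U_lift.
Qed.

End Family.

Lemma graph_relations0 x y : graph_relations E ord0 x y = (x == y).
Proof. by rewrite /graph_relations unlift_none. Qed.

Lemma graph_relations_lift i x y : graph_relations E (lift ord0 i) x y = E i x y.
Proof. by rewrite /graph_relations liftK. Qed.

Theorem amorphic_orthogonal : amorphic (graph_relations E).
Proof.
split=> [|Pi partPi].
  apply: (@assoc_scheme_union d (fun i => [set i])) => [i j ij|k|x y|i x y].
  - by rewrite disjoints1 inE.
  - by exists k; rewrite inE.
  - exact: graph_relations0.
  - by rewrite graph_relations_lift union_rel1.
case/and3P: partPi => /eqP covPi /trivIsetP trivPi _.
apply: (@assoc_scheme_union #|Pi| enum_val) => [i j ij|k|x y|i x y].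
- by apply: trivPi; rewrite ?enum_valP ?(inj_eq enum_val_inj).
- have : k \in cover Pi by rewrite covPi inE.
  by case/bigcupP => S SPi kS; exists (enum_rank_in SPi S); rewrite enum_rankK_in.
- by rewrite /fusion unlift_none graph_relations0.
- by rewrite /fusion liftK; apply: eq_existsb => k; rewrite graph_relations_lift.
Qed.

Lemma strongly_regular_orthogonal i : (0 < #|X|)%N ->
  exists v k lam mu, strongly_regular (E i) v k lam mu.
Proof.
move=> /card_gt0P[x0 _].
have [t tE] := @count_union_rel [set i] [set i] (or_introl erefl).
exists #|X|, (t false false true), (t true true false), (t false false false).
split=> // [x|x y /negbTE xy].
  rewrite -(union_rel_irr [set i] x) -[X in t _ _ X](eqxx x) -tE.
  by apply: eq_card => y; rewrite !inE !union_rel1 [E i y x]E_sym andbb.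
have := tE x y; rewrite xy union_rel1.
have -> : [set z | union_rel [set i] x z && union_rel [set i] z y]
        = [set z | E i x z && E i z y].
  by apply/setP => z; rewrite !inE !union_rel1.
by move=> ->; case: (E i x y).
Qed.

End Amorphic.

Lemma partial_difference_set_cayley (G : finZmodType) (D : {set G}) v k lam mu :
  strongly_regular (cayley D) v k lam mu -> partial_difference_set D v k lam mu.
Proof.
case=> Dsym _ cardG degD countD.
have DN x : (- x \in D) = (x \in D).
  by have := Dsym 0 x; rewrite /cayley sub0r subr0.
split=> // [|x x0].
  rewrite -(degD 0); apply: eq_card => x.
  by rewrite inE /cayley sub0r DN.
have := countD x 0 x0; rewrite /cayley subr0 => <-.
(* The pair with difference [x] and first member [z] is [(z, z - x)]. *)
have pair_inj : injective (fun z => (z, z - x)) by move=> z1 z2 [].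
rewrite -(card_imset _ pair_inj).
apply: eq_card => -[d1 d2]; rewrite !inE /=; apply/idP/imsetP => [|[z]].
  case/and4P => d1D d2D _ /eqP dx; exists d1; last by rewrite -dx subKr.
  by rewrite inE subr0 d1D andbT -DN opprB -dx subKr.
rewrite inE subr0 => /andP[xzD zD] [-> ->].
by rewrite subKr eqxx zD -DN opprB xzD andbT -subr_eq0 opprB addrC subrK.
Qed.

(** * Level sets *)

Section Levels.

Definition level (U : finType) (R : eqType) (f : U -> R) (a : R) : nat :=
  #|[set x | f x == a]|.

Lemma level_sum (U : finType) (R : eqType) (f : U -> R) a :
  level f a = (\sum_x (f x == a))%N.
Proof.
rewrite /level -sum1_card big_mkcond /=.
by apply: eq_bigr => x _; rewrite inE; case: eqP.
Qed.

Lemma level_bij (U W : finType) (R S : eqType) (h : U -> W) f g (a : R) (b : S) :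
  bijective h -> (forall x, (f x == a) = (g (h x) == b)) -> level f a = level g b.
Proof.
move=> [h' hK h'K] fg; rewrite /level -(card_imset _ (can_inj hK)).
apply: eq_card => y; rewrite -[y in LHS]h'K mem_imset; last exact: can_inj hK.
by rewrite !inE fg h'K.
Qed.

Lemma sum_level (U R : finType) (f : U -> R) (S : {set R}) :
  (forall x, f x \in S) -> (\sum_(a in S) level f a = #|U|)%N.
Proof.
move=> fS; rewrite -sum1_card (partition_big f (mem S)) => [|x _]; last exact: fS.
by apply: eq_bigr => a _; rewrite /level -sum1_card; apply: eq_bigl => x; rewrite inE.
Qed.

Lemma level_const (U R : finType) (f : U -> R) (S : {set R}) a :
  (forall x, f x \in S) -> (forall b, b \in S -> level f b = level f a) ->
  (#|S| * level f a = #|U|)%N.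
Proof. by move=> /sum_level<- fa; rewrite (eq_bigr _ fa) sum_nat_const. Qed.

(** The levels of an additive map are translates of one another. *)
Lemma level_additive (U R : finZmodType) (f : U -> R) (S : {set R}) :
  {morph f : x y / x + y} -> (forall x, f x \in S) ->
  (forall b, b \in S -> exists x, f x = b) ->
  forall a, a \in S -> (#|S| * level f a = #|U|)%N.
Proof.
move=> fD fS f_onto a /f_onto[x fx]; apply: level_const => // b /f_onto[y fy].
apply: (@level_bij _ _ _ _ (fun z => z + (x - y))) => [|z].
  by exists (fun z => z - (x - y)) => z; rewrite ?addrK ?subrK.
rewrite -(inj_eq (addIr (f y))) -[RHS](inj_eq (addIr (f y))) -!fD -addrA subrK.
by rewrite !fD fx fy (addrC a) (inj_eq (addIr a)) (inj_eq (addIr b)).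
Qed.

End Levels.

(** * Counting in a pencil of quadratic forms *)

Section QuadraticFormTheory.

Variables (F : fieldType) (n : nat) (Q : 'rV[F]_n -> F).
Hypothesis hQ : quadratic_form Q.
Implicit Types v w z : 'rV[F]_n.

Lemma quadZ c v : Q (c *: v) = c ^+ 2 * Q v.
Proof. by case: hQ. Qed.

Lemma quad0 : Q 0 = 0.
Proof. by have := quadZ 0 0; rewrite scale0r expr0n mul0r. Qed.

Lemma polarZDr c v w z : polar Q v (c *: w + z) = c * polar Q v w + polar Q v z.
Proof. by case: hQ => _ [_ lin]; have /= := lin v c w z. Qed.

Lemma polarDr v : {morph polar Q v : w z / w + z}.
Proof. by move=> w z; rewrite -[w in LHS]scale1r polarZDr mul1r. Qed.

Lemma polarC v w : polar Q v w = polar Q w v.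
Proof. by rewrite /polar [w + v]addrC addrAC. Qed.

Lemma polar0r v : polar Q v 0 = 0.
Proof. by rewrite /polar addr0 quad0 subr0 subrr. Qed.

Lemma quadD v w : Q (v + w) = Q v + Q w + polar Q v w.
Proof. by rewrite /polar; ring. Qed.

Lemma quadDZ c z w : Q (z + c *: w) = Q z + c * polar Q w z + c ^+ 2 * Q w.
Proof.
by rewrite quadD quadZ -[c *: w]addr0 polarZDr polar0r polarC; ring.
Qed.

Lemma quadN v : Q (- v) = Q v.
Proof. by rewrite -scaleN1r quadZ sqrrN expr1n mul1r. Qed.

Lemma quadBC v w : Q (v - w) = Q (w - v).
Proof. by rewrite -quadN opprB. Qed.

Lemma quadB w z : Q (w - z) = Q z - polar Q w z + Q w.
Proof. by rewrite quadBC -scaleN1r quadDZ; ring. Qed.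

End QuadraticFormTheory.

Section FiniteField.

Variables (F : finFieldType) (n : nat) (Q : 'rV[F]_n -> F).
Hypothesis hQ : quadratic_form Q.
Local Notation V := 'rV[F]_n.

(** Here [2 * Q w = polar Q w w = 0], so the characteristic is 2; then every
    element is a square and translation by [c *: w] moves [Q] by the arbitrary
    amount [c ^+ 2 * Q w]. *)
Lemma level_polar_radical (w : V) : (forall z, polar Q w z = 0) -> Q w != 0 ->
  forall a, (#|F| * level Q a = #|V|)%N.
Proof.
move=> w_rad Qw0 a.
have char2 : 2 \in [pchar F].
  rewrite inE /=; have := w_rad w.
  rewrite /polar -[w + w](_ : 2 *: w = _); last by rewrite scalerDl scale1r.
  rewrite quadZ // => /eqP; rewrite [X in X == 0](_ : _ = 2 * Q w); last by ring.
  by rewrite mulf_eq0 (negbTE Qw0) orbF.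
have sqr_inj : injective (fun x : F => x ^+ 2).
  by apply: (fmorph_inj (pFrobenius_aut char2)).
rewrite -cardsT; apply: level_const => [x|b _]; first by rewrite inE.
pose c := invF sqr_inj ((a - b) / Q w).
apply: (@level_bij _ _ _ _ (fun z => z + c *: w)) => [|z].
  by exists (fun z => z - c *: w) => z; rewrite ?addrK ?subrK.
rewrite quadDZ // w_rad mulr0 addr0 [c ^+ 2](f_invF sqr_inj) divfK //.
by rewrite -subr_eq0 -[RHS]subr_eq0; congr (_ == 0); ring.
Qed.

(** [K] is a subfield, given as a subset of [F], and [tau] a [K]-linear map onto
    it.  Both cases [K = F], [tau = id] and [K] of index two, [tau] a multiple of
    the trace, are needed. *)
Section Pencil.

Variables (K : {set F}) (tau : F -> F).
Hypothesis K_divring : divring_closed K.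
Hypothesis tau_lin : forall a x y, a \in K -> tau (a * x + y) = a * tau x + tau y.
Hypothesis tauK : forall x, tau x \in K.
Hypothesis tau_onto : forall b, b \in K -> exists x, tau x = b.

Let T (x : V) := tau (Q x).
Let k := #|K|.
Let both_zero (w : V) := [set z | (T z == 0) && (T (w - z) == 0)].
Implicit Types w z : V.

Let K1 : 1 \in K. Proof. by case: K_divring. Qed.
Let KB a b : a \in K -> b \in K -> a - b \in K.
Proof. by case: K_divring => _ + _; apply. Qed.
Let Kdiv a b : a \in K -> b \in K -> a / b \in K.
Proof. by case: K_divring => _ _; apply. Qed.
Let K0 : 0 \in K. Proof. by rewrite -(subrr 1) KB. Qed.
Let KN a : a \in K -> - a \in K.
Proof. by move=> aK; rewrite -sub0r KB. Qed.
Let KD a b : a \in K -> b \in K -> a + b \in K.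
Proof. by move=> aK bK; rewrite -[b]opprK KB ?KN. Qed.

Let tauD : {morph tau : x y / x + y}.
Proof. by move=> x y; rewrite -[x in LHS]mul1r tau_lin // mul1r. Qed.
Let tau0 : tau 0 = 0.
Proof. by apply: (addrI (tau 0)); rewrite -tauD !addr0. Qed.
Let tauZ a x : a \in K -> tau (a * x) = a * tau x.
Proof. by move=> aK; rewrite -[a * x]addr0 tau_lin // tau0 addr0. Qed.

Let tauB x y : tau (x - y) = tau x - tau y.
Proof. by apply/eqP; rewrite eq_sym subr_eq -tauD subrK. Qed.

(** A pair [(a, b)] other than [(0, 0)] satisfies [t * a + s * b = 0] for
    exactly one point [(t : s)] of the projective line over [K]; the point
    [(0 : 1)] gives the last term on the right. *)
Lemma count_both_zero w :
  (k * #|both_zero w| + #|{: V}|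
   = \sum_(s in K) level (fun z => T z + s * T (w - z))%R 0%R + level T 0%R)%N.
Proof.
have -> : level T 0 = level (fun z => T (w - z)) 0.
  apply: (@level_bij _ _ _ _ (fun z => w - z)) => [|z]; last by rewrite subKr.
  by exists (fun z => w - z) => z; rewrite subKr.
rewrite level_sum (eq_bigr _ (fun s _ => level_sum _ _)) exchange_big /= -big_split /=.
rewrite -[#|both_zero w|]sum1_card -sum1_card big_distrr /= big_mkcond.
rewrite -big_split /=; apply: eq_bigr => z _; rewrite inE muln1.
have [Tb0|Tb0] := eqVneq (T (w - z)) 0.
  rewrite Tb0 andbT; under [in RHS]eq_bigr do rewrite mulr0 addr0.
  by rewrite sum_nat_const; case: (T z == 0); rewrite ?muln1 ?muln0.
rewrite andbF add0n addn0 (bigD1 (- (T z / T (w - z)))) /=; last first.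
  by rewrite KN // Kdiv ?tauK.
rewrite mulNr divfK // subrr eqxx big1 // => s /andP[_ sN].
apply/eqP; rewrite eqb0; apply: contraNneq sN => e; apply/eqP.
by rewrite -mulNr; apply: (mulIf Tb0); rewrite divfK //; apply/eqP;
  rewrite -addr_eq0 addrC e.
Qed.

(** Completing the square: [Q z + s * Q (w - z)], seen as a form in [z], is
    [(1 + s) * Q z' + s / (1 + s) * Q w] with [z' = z - s / (1 + s) *: w]. *)
Lemma level_pencil w s : s \in K -> s != -1 ->
  level (fun z => T z + s * T (w - z)) 0
  = level T (- (s / (1 + s) ^+ 2) * T w).
Proof.
move=> sK; rewrite -subr_eq0 opprK addrC => s1; set c := s / (1 + s).
have cK : c \in K by rewrite Kdiv ?KD.
apply: (@level_bij _ _ _ _ (fun z => z + (- c) *: w)) => [|z].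
  by exists (fun z => z - (- c) *: w) => z; rewrite ?addrK ?subrK.
have -> : T z + s * T (w - z)
        = (1 + s) * (T (z + (- c) *: w) + s / (1 + s) ^+ 2 * T w).
  rewrite mulrDr mulrA (_ : (1 + s) * (s / (1 + s) ^+ 2) = c); last by rewrite /c; field.
  rewrite /T -!tauZ ?KD // -!tauD quadB // quadDZ //.
  by congr tau; rewrite /c; field.
by rewrite mulf_eq0 (negbTE s1) /= addr_eq0 mulNr.
Qed.

(** For [s = -1] the quadratic terms cancel, leaving an affine condition. *)
Lemma level_pencilN1 w : (exists z, polar Q w z != 0) ->
  (k * level (fun z => (T z + -1 * T (w - z))%R) 0%R = #|{: V}|)%N.
Proof.
move=> [z0 Bz0].
have onto b : b \in K -> exists z, tau (polar Q w z) = b.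
  move=> /tau_onto[x <-]; exists ((x / polar Q w z0) *: z0 + 0).
  by rewrite polarZDr // polar0r // addr0 divfK.
have fD : {morph (fun z => tau (polar Q w z)) : x y / x + y}.
  by move=> x y /=; rewrite polarDr // tauD.
have := level_additive fD (fun z => tauK _) onto (tauK (Q w)).
congr (_ * _ = _)%N; apply: (@level_bij _ _ _ _ id) => [|z]; first by exists id.
have -> : T (w - z) = T z + (tau (Q w) - tau (polar Q w z)).
  by rewrite /T quadB // tauD tauB -addrA [- _ + _]addrC.
by rewrite mulN1r opprD addNKr oppr_eq0 subr_eq0 eq_sym.
Qed.

(** The members [T z] and [T (w - z)] of the pencil contribute the first term
    and the affine member the part [k^-1 * #|V|] of the second. *)
Lemma count_both_zeroE w : (exists z, polar Q w z != 0) ->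
  k%:R * #|both_zero w|%:R
  = 2 * (level T 0)%:R + (k%:R^-1 - 1) * #|{: V}|%:R
    + \sum_(s in K :\ 0 :\ -1) (level T (- (s / (1 + s) ^+ 2) * T w))%:R :> rat.
Proof.
move=> /level_pencilN1 ME.
have k_neq0 : k%:R != 0 :> rat.
  by rewrite pnatr_eq0 -lt0n; apply/card_gt0P; exists 0.
have := congr1 (fun m => m%:R : rat) (count_both_zero w).
rewrite natrD natrM natrD natr_sum => /(canRL (addrK _)) ->.
rewrite (big_setD1 0) //= (big_setD1 (-1)) /=; last first.
  by rewrite !inE oppr_eq0 oner_eq0 KN.
have -> : (level (fun z => T z + 0 * T (w - z)) 0) = level T 0.
  apply: (@level_bij _ _ _ _ id) => [|z]; first by exists id.
  by rewrite mul0r addr0.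
have -> : \sum_(s in K :\ 0 :\ -1) (level (fun z => T z + s * T (w - z)) 0)%:R
        = \sum_(s in K :\ 0 :\ -1) (level T (- (s / (1 + s) ^+ 2) * T w))%:R :> rat.
  by apply: eq_bigr => s; rewrite !inE => /and3P[sN1 _ sK]; rewrite level_pencil.
by rewrite -ME natrM; field.
Qed.

End Pencil.

End FiniteField.

(** * Level sets of elliptic forms *)

Section EllipticLevels.

Variable F : finFieldType.
Local Notation r := (#|F|%:R : rat).

Lemma card_field_gt1 : (1 < #|F|)%N.
Proof.
rewrite (cardD1 0) (cardD1 1) !inE oner_eq0 /=.
by rewrite addnA.
Qed.

Lemma card_field_neq0 : r != 0.
Proof. by rewrite pnatr_eq0 -lt0n ltnW ?card_field_gt1. Qed.

Lemma level_quad_sqr n (Q : 'rV[F]_n -> F) c a : quadratic_form Q -> c != 0 ->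
  level Q (c ^+ 2 * a) = level Q a.
Proof.
move=> hQ c0; symmetry; apply: (@level_bij _ _ _ _ ( *:%R c)) => [|x].
  by exists ( *:%R c^-1) => x; rewrite scalerA ?mulVf ?mulfV // scale1r.
by rewrite quadZ // (inj_eq (mulfI _)) // expf_neq0.
Qed.

Section Anisotropic.

Variable Q : 'rV[F]_2 -> F.
Hypothesis hQ : quadratic_form Q.
Hypothesis Q_aniso : forall x, Q x = 0 -> x = 0.

Lemma level_aniso0 : level Q 0 = 1%N.
Proof.
rewrite /level (_ : [set x | _] = [set 0]) ?cards1 //.
by apply/setP => x; rewrite !inE; apply/eqP/eqP => [/Q_aniso //|->]; rewrite quad0.
Qed.

Lemma polar_aniso w : w != 0 -> exists z, polar Q w z != 0.
Proof.
move=> w0; apply/existsP; apply: contraNT w0 => /existsPn w_rad.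
apply/eqP/Q_aniso/eqP; apply: contraTT card_field_gt1 => Qw0.
have := @level_polar_radical F 2 Q hQ w (fun z => eqP (negbNE (w_rad z))) Qw0 0.
rewrite level_aniso0 muln1 card_mx mul1n -[LHS]muln1 expnS expn1 => /eqP.
by rewrite eqn_pmul2l ?(ltnW card_field_gt1) // => /eqP <-.
Qed.

(** In the count of the common zeros of [Q z] and [Q (w - z)], which is zero,
    the level sums over the pencil run through all values except [0] and
    [Q w], up to square factors, so that only [level Q (Q w)] is unknown. *)
Lemma level_aniso_value w : w != 0 -> (level Q (Q w))%:R = r + 1.
Proof.
move=> w0; have Qw0 : Q w != 0 by apply: contraNneq w0 => /Q_aniso ->.
have divT : divring_closed [set: F] by split=> [|x y _ _|x y _ _]; rewrite inE.
have := @count_both_zeroE F 2 Q hQ setT id divT (fun a x y _ => erefl)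
  (fun x => in_setT x) (fun b _ => ex_intro _ b erefl) w (polar_aniso w0).
rewrite cardsT level_aniso0 card_mx mul1n natrX.
rewrite (_ : [set z | _] = set0) ?cards0 ?mulr0; last first.
  apply/setP => z; rewrite !inE; apply/negP => /andP[/eqP/Q_aniso->].
  by rewrite subr0 (negbTE Qw0).
rewrite (_ : \sum_(s in _) _ = \sum_(a in setT :\ 0 :\ Q w) (level Q a)%:R); last first.
  rewrite [RHS](reindex_onto (fun s => - s * Q w) (fun a => - (a / Q w))) /=; last first.
    by move=> a _; rewrite opprK divfK.
  apply: eq_big => [s|s].
    rewrite !inE !andbT mulfK // opprK eqxx andbT mulf_eq0 (negbTE Qw0) orbF oppr_eq0.
    congr (~~ _ && _); rewrite -[RHS]subr_eq0 -[X in _ * _ - X]mul1r -mulrBl.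
    by rewrite mulf_eq0 (negbTE Qw0) orbF -opprD oppr_eq0 addr_eq0.
  rewrite !inE !andbT => /andP[sN1 _].
  have s1 : 1 + s != 0 by rewrite addrC -[1]opprK subr_eq0.
  rewrite -(level_quad_sqr (- s * Q w) hQ (invr_neq0 s1)) /=.
  by congr (level Q _)%:R; field.
have := sum_level (fun x => in_setT (Q x)); rewrite card_mx mul1n.
rewrite (big_setD1 0) ?inE //= (big_setD1 (Q w)) ?inE ?Qw0 //= level_aniso0.
move=> /(congr1 (fun m => m%:R : rat)); rewrite !natrD natr_sum natrX.
set S := \sum_(a in _) _ => tot eq0.
apply/eqP; rewrite -subr_eq0; apply/eqP.
rewrite (_ : _ - _ = (1 + ((level Q (Q w))%:R + S) - r ^+ 2)
  - (2 * 1 + (r^-1 - 1) * r ^+ 2 + S)); last by field; exact: card_field_neq0.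
by rewrite tot -eq0 !subrr.
Qed.

(** A value which is taken is taken [r + 1] times, and the [r ^ 2 - 1] nonzero
    vectors are just enough to take all [r - 1] nonzero values. *)
Lemma level_aniso a : (level Q a)%:R = r + 1 - r * (a == 0)%:R.
Proof.
have [->|a0] := eqVneq a 0; first by rewrite level_aniso0 mulr1 addrAC subrr add0r.
rewrite mulr0 subr0.
have le b : b \in setT :\ 0 -> 0 <= r + 1 - (level Q b)%:R.
  rewrite !inE andbT => b0; rewrite subr_ge0.
  have [->|] := posnP (level Q b); first by rewrite addr_ge0.
  move=> /card_gt0P[x]; rewrite inE => /eqP Qx.
  rewrite -Qx level_aniso_value //; apply: contraNneq b0 => x0.
  by rewrite -Qx x0 quad0.
have tot : \sum_(b in setT :\ 0) (r + 1 - (level Q b)%:R) = 0.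
  rewrite sumrB sumr_const; have := sum_level (fun x => in_setT (Q x)).
  rewrite card_mx mul1n (big_setD1 0) ?inE //= level_aniso0.
  move=> /(congr1 (fun m => m%:R : rat)); rewrite !natrD natr_sum natrX.
  move=> /(canRL (addKr _)) ->; rewrite -[_ *+ #|_|]mulr_natr.
  set c := (X in (_ + 1) * X - _); have -> : c = r - 1.
    by rewrite /c -cardsT (cardsD1 0 setT) inE natrD addrAC subrr add0r.
  by ring.
move/eqP: tot; rewrite psumr_eq0 // => /allP/(_ a (mem_index_enum a)).
by rewrite !inE a0 subr_eq0 /= => /eqP.
Qed.

End Anisotropic.

Lemma sum_const_neq (x : F) (c : rat) : \sum_(v | v != x) c = (r - 1) * c.
Proof.
rewrite sumr_const -[_ *+ _]mulr_natl; congr (_ * c).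
rewrite (cardD1 x F) inE natrD addrAC subrr add0r; congr _%:R.
by apply: eq_card => v; rewrite !inE andbT.
Qed.

(** Adding a hyperbolic plane: [u * v = a] has [r - 1] solutions, and [r] more
    when [a = 0]. *)
Lemma level_hyperbolic (U : finType) (f : U -> F) (alpha beta : rat) :
  (forall a, (level f a)%:R = alpha - beta * (a == 0)%:R) ->
  forall a, (level (fun z : U * (F * F) => f z.1 + z.2.1 * z.2.2) a)%:R
    = r ^+ 2 * alpha - beta * (r - 1) - beta * r * (a == 0)%:R.
Proof.
move=> fE a.
have -> : level (fun z : U * (F * F) => f z.1 + z.2.1 * z.2.2) a
    = (\sum_(u : F) \sum_(v : F) level f (a - u * v)%R)%N.
  rewrite level_sum.
  rewrite -(pair_bigA _ (fun x uv => nat_of_bool (f x + uv.1 * uv.2 == a)%R)) /=.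
  rewrite exchange_big /= (pair_bigA _ (fun u v => level f (a - u * v)%R)) /=.
  apply: eq_bigr => uv _; rewrite level_sum; apply: eq_bigr => x _.
  by rewrite eq_sym -subr_eq eq_sym.
rewrite natr_sum (bigD1 0) //=.
have -> : (\sum_(v : F) level f (a - 0 * v)%R)%N%:R = r * (alpha - beta * (a == 0)%:R).
  rewrite (eq_bigr (fun=> level f a)) => [|v _]; last by rewrite mul0r subr0.
  by rewrite sum_nat_const natrM fE.
rewrite (eq_bigr (fun=> r * alpha - beta)) => [|u u0].
  by rewrite sum_const_neq; ring.
rewrite natr_sum (bigD1 (a / u)) //= mulrC divfK // subrr fE eqxx mulr1.
rewrite (eq_bigr (fun=> alpha)) => [|v va].
  by rewrite sum_const_neq; ring.
rewrite fE subr_eq0 (_ : (a == u * v) = false) ?mulr0 ?subr0 //.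
by apply: contraNF va => /eqP ->; rewrite mulrC mulKf.
Qed.

End EllipticLevels.

(** * Irreducible binary quadratic forms *)

Section BinaryForms.

Variable F : fieldType.
Variable p : {mpoly F[2]}.
Hypothesis p_homog : p \is 2.-homog.

Let i0 : 'I_2 := ord0.
Let i1 : 'I_2 := ord_max.

Lemma binary_formE : exists a b c : F,
  p = a *: 'X_i0 ^+ 2 + b *: ('X_i0 * 'X_i1) + c *: 'X_i1 ^+ 2.
Proof.
exists p@_(U_(i0) + U_(i0)), p@_(U_(i0) + U_(i1)), p@_(U_(i1) + U_(i1)).
rewrite !expr2 -!mpolyXD; apply/mpolyP => m.
rewrite !mcoeffD !mcoeffZ !mcoeffX.
have [m2|m2] := eqVneq (mdeg m) 2%N; last first.
  rewrite (dhomog_nemf_coeff p_homog m2).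
  have ne i j : (U_(i) + U_(j) == m)%MM = false :> bool.
    by apply: contraNF m2 => /eqP <-; rewrite mdegD !mdeg1.
  by rewrite !ne !mulr0 !addr0.
have mE m' : (m' == m) = (m' i0 == m i0) && (m' i1 == m i1).
  apply/eqP/andP => [->//|[/eqP e0 /eqP e1]]; apply/mnmP => i.
  case: (unliftP ord0 i) => [j|] -> //; rewrite [lift _ _](_ : _ = i1) //.
  by apply: val_inj; rewrite /= ord1.
have m_sum : (m i0 + m i1 = 2)%N.
  apply: etrans m2; rewrite mdegE big_ord_recr big_ord1 /=.
  by congr (m _ + m _)%N; apply: val_inj.
have coefE i j : (U_(i) + U_(j))%MM == m -> p@_(U_(i) + U_(j)) = p@_m.
  by move=> /eqP ->.
have e1 : m i1 = (2 - m i0)%N by apply: (canRL (addKn _)).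
have : (m i0 <= 2)%N by apply: leq_trans (leq_addr _ _) (eq_leq m_sum).
rewrite !mE; case e0: (m i0) => [|[|[|//]]] _; rewrite e0 in e1.
- rewrite -(coefE i1 i1); last by rewrite mE !mnmDE !mnm1E e0 e1.
  by rewrite !mnmDE !mnm1E e1 /= !mulr0 mulr1 !add0r.
- rewrite -(coefE i0 i1); last by rewrite mE !mnmDE !mnm1E e0 e1.
  by rewrite !mnmDE !mnm1E e1 /= !mulr0 mulr1 !add0r addr0.
- rewrite -(coefE i0 i0); last by rewrite mE !mnmDE !mnm1E e0 e1.
  by rewrite !mnmDE !mnm1E e1 /= !mulr0 mulr1 !addr0.
Qed.

Definition binary_value (x : 'rV[F]_2) : F := p.@[fun i => x ord0 i].

Lemma binary_valueE : exists a b c : F, forall x : 'rV[F]_2, binary_value x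
  = a * x ord0 i0 ^+ 2 + b * (x ord0 i0 * x ord0 i1) + c * x ord0 i1 ^+ 2.
Proof.
have [a [b [c pE]]] := binary_formE; exists a, b, c => x.
by rewrite /binary_value pE !mevalD !mevalZ !rmorphXn /= mevalM !mevalXU.
Qed.

Lemma binary_quadratic : quadratic_form binary_value.
Proof.
have [a [b [c pE]]] := binary_valueE; split=> [t v|].
  by rewrite !pE !mxE; ring.
have BE v w : polar binary_value v w
    = 2 * a * (v ord0 i0 * w ord0 i0) + 2 * c * (v ord0 i1 * w ord0 i1)
      + b * (v ord0 i0 * w ord0 i1 + v ord0 i1 * w ord0 i0).
  by rewrite /polar !pE !mxE; ring.
by split=> w t u v; rewrite !BE !mxE /=; apply/eqP; rewrite -subr_eq0; apply/eqP; ring.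
Qed.

(** A zero [(x0, x1)] of [p], normalised so that one coordinate is [1], gives a
    factorisation of [p] into two linear forms; linear forms vanish at the
    origin, so they are not units. *)
Lemma irreducible_aniso : irreducible_elt p ->
  forall x, binary_value x = 0 -> x = 0.
Proof.
case=> _ irr x; have [a [b [c pE]]] := binary_formE.
have no_factor f g : p = f * g -> f.@[fun=> 0] = 0 -> g.@[fun=> 0] = 0 -> False.
  move=> /irr fg f0 g0; case: fg => /(rmorph_unit (meval (fun=> 0))) /=.
    by rewrite f0 unitr0.
  by rewrite g0 unitr0.
rewrite /binary_value pE !mevalD !mevalZ !rmorphXn /= mevalM !mevalXU => px.
have [x1|x1] := eqVneq (x ord0 i1) 0.
  apply/rowP => i; rewrite mxE; case: (unliftP ord0 i) => [j|] ->.
    by rewrite [lift _ _](_ : _ = i1) //; apply: val_inj; rewrite /= ord1.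
  apply/eqP/negPn/negP => x0; move: px.
  rewrite x1 mulr0 expr0n !mulr0 !addr0 => /eqP.
  rewrite mulf_eq0 (negbTE (expf_neq0 2 x0)) orbF => /eqP a0.
  apply: (@no_factor 'X_i1 (b *: 'X_i0 + c *: 'X_i1)).
  - by rewrite pE a0 scale0r add0r mulrDr -!scalerAr mulrC -expr2 mulrC.
  - by rewrite mevalXU.
  - by rewrite mevalD !mevalZ !mevalXU !mulr0 addr0.
pose rho := x ord0 i0 / x ord0 i1.
have rho0 : a * rho ^+ 2 + b * rho + c = 0.
  apply: (mulIf (expf_neq0 2 x1)); rewrite mul0r -px /rho; field.
  exact: x1.
case: (@no_factor ('X_i0 - rho *: 'X_i1) (a *: 'X_i0 + (a * rho + b) *: 'X_i1)).
- rewrite pE (_ : c = - (a * rho + b) * rho); last first.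
    by apply/eqP; rewrite -subr_eq0; apply/eqP; rewrite -[RHS]rho0; ring.
  by rewrite -!mul_mpolyC !(mpolyCD, mpolyCM, mpolyCN); ring.
- by rewrite mevalB mevalZ !mevalXU mulr0 subr0.
- by rewrite mevalD !mevalZ !mevalXU !mulr0 addr0.
Qed.

End BinaryForms.

Section EllipticForms.

Variables (F : finFieldType) (p : {mpoly F[2]}).
Hypothesis p_homog : p \is 2.-homog.
Hypothesis p_irr : irreducible_elt p.
Local Notation r := (#|F|%:R : rat).

Lemma vcoord_row n (f : nat -> F) k :
  vcoord (\row_(i < n) f i) k = if (k < n)%N then f k else 0.
Proof. by rewrite /vcoord; case: insubP => [i -> /= <-|/negbTE ->]; rewrite ?mxE. Qed.

Lemma vcoord_ord n (x : 'rV[F]_n) (i : 'I_n) : vcoord x i = x ord0 i.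
Proof. by rewrite /vcoord valK. Qed.

Lemma vcoordP n (x y : 'rV[F]_n) :
  (forall k, (k < n)%N -> vcoord x k = vcoord y k) -> x = y.
Proof. by move=> xy; apply/rowP => i; rewrite -!vcoord_ord xy. Qed.

(** The binary form starts an induction in which each step adds a hyperbolic
    plane. *)
Lemma elliptic_model_level l a :
  (level (elliptic_model p : 'rV[F]_(2 * l.+1) -> F) a)%:R
  = ((r ^+ l.+1) ^+ 2 + r ^+ l.+1) / r - r ^+ l.+1 * (a == 0)%:R.
Proof.
elim: l a => [|l IHl] a.
  have -> : level (elliptic_model p : 'rV[F]_(2 * 1) -> F) a
          = level (binary_value p) a.
    apply: (@level_bij _ _ _ _ id) => [|x]; first by exists id.
    rewrite /elliptic_model big_geq // addr0; congr (_ == a).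
    by apply: meval_eq => i; rewrite -vcoord_ord.
  rewrite level_aniso ?expr1; [|exact: binary_quadratic|exact: irreducible_aniso].
  by congr (_ - _); field; exact: card_field_neq0.
(* The last two coordinates, with numbers [N] and [N + 1], are split off. *)
set N := (2 * l.+1)%N.
have N2 : (2 * l.+2 = N.+2)%N by rewrite mulnS.
have NSN : (N.+1 == N) = false by rewrite eqn_leq ltnn.
pose h (z : 'rV[F]_N * (F * F)) : 'rV[F]_(2 * l.+2) :=
  \row_i (if (i < N)%N then vcoord z.1 i else if i == N :> nat then z.2.1 else z.2.2).
pose h' (x : 'rV[F]_(2 * l.+2)) : 'rV[F]_N * (F * F) :=
  (\row_i vcoord x i, (vcoord x N, vcoord x N.+1)).
have hE z k : vcoord (h z) k = if (k < N)%N then vcoord z.1 k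
    else if k == N then z.2.1 else if k == N.+1 then z.2.2 else 0.
  rewrite /h (vcoord_row _ (fun k => if (k < N)%N then vcoord z.1 k
    else if k == N then z.2.1 else z.2.2)) N2 ltnS.
  have [kN|Nk|->] := ltngtP k N; first by rewrite leqW // ltnW.
    by rewrite leq_eqVlt ltnS leqNgt Nk orbF.
  by rewrite leqnSn.
have hK : cancel h h'.
  move=> [y [u v]]; rewrite /h' !hE ltnn !eqxx NSN ltnNge leqnSn /=.
  congr (_, _); apply: vcoordP => k kN.
  by rewrite (vcoord_row _ (fun k => vcoord (h (y, (u, v))) k)) kN hE kN.
have h'K : cancel h' h.
  move=> x; apply: vcoordP => k; rewrite [X in (_ < X)%N -> _]N2 hE /= => kN.
  rewrite (vcoord_row _ (fun k => vcoord x k)).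
  case: ltnP => [//|Nk]; case: eqP => [->//|/eqP kNN]; case: eqP => [->//|/eqP kN1].
  by move: kN; rewrite ltnS leq_eqVlt (negbTE kN1) ltnS leqNgt ltn_neqAle eq_sym kNN Nk.
have := level_hyperbolic IHl a.
have -> : level (fun z : 'rV[F]_N * (F * F) => elliptic_model p z.1 + z.2.1 * z.2.2) a
        = level (elliptic_model p : 'rV[F]_(2 * l.+2) -> F) a.
  apply: (level_bij (h := h)) => [|z]; first by exists h'.
  congr (_ == a); rewrite /elliptic_model [in RHS]big_nat_recr //= -/N !hE.
  rewrite ltnn !eqxx NSN ltnNge leqnSn /= addrA.
  congr (_ + _ + _).
    by apply: meval_eq => i; rewrite hE (leq_trans (ltn_ord i)) ?/N ?mulnS.
  apply: eq_big_nat => j /andP[_ jl].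
  have jN : ((2 * j).+1 < N)%N.
    by rewrite -addn2 -[X in (_ + X)%N](muln1 2) -mulnDr addn1 leq_mul2l.
  by rewrite !hE jN ltnW.
move=> ->; rewrite [r ^+ l.+2]exprS; set m := r ^+ l.+1.
by have r0 := card_field_neq0 F; field.
Qed.

End EllipticForms.

(** * Zero relations and their idempotents *)

Section ZeroRelation.

Variables (F : finFieldType) (n : nat) (Q : 'rV[F]_n -> F).
Variables (K : {set F}) (tau : F -> F) (m : rat).
Local Notation V := 'rV[F]_n.
Local Notation k := (#|K|%:R : rat).
Local Notation J := (const_mx 1 : 'M[rat]_#|V|).

Hypothesis hQ : quadratic_form Q.
Hypothesis polarQ : forall w : V, w != 0 -> exists z, polar Q w z != 0.
Hypothesis K_divring : divring_closed K.
Hypothesis tau_lin : forall a x y, a \in K -> tau (a * x + y) = a * tau x + tau y.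
Hypothesis tauK : forall x, tau x \in K.
Hypothesis tau_onto : forall b, b \in K -> exists x, tau x = b.
Hypothesis m_neq0 : m != 0.
Hypothesis cardV : #|{: V}|%:R = m ^+ 2.
Hypothesis level_tau : forall a, a \in K ->
  (level (fun x => tau (Q x)) a)%:R = (m ^+ 2 + m) / k - m * (a == 0)%:R.

Definition zero_rel : rel V := fun x y => tau (Q (x - y)) == 0.

(** The eigenvalues of [zero_rel] on the vectors orthogonal to the all-one vector
    are [m / k] and [m / k - m]; this is the projection onto the eigenspace of
    the second one. *)
Definition zero_idem : 'M[rat]_#|V| :=
  k^-1 *: 1%:M - m^-1 *: relmx zero_rel + ((k * m)^-1 - (m ^+ 2)^-1) *: J.

Let k_neq0 : k != 0.
Proof.
rewrite pnatr_eq0 -lt0n; apply/card_gt0P; exists 1.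
by case: K_divring.
Qed.

Lemma relmx_zero_rel :
  relmx zero_rel = - m *: zero_idem + (m / k) *: 1%:M + (k^-1 - m^-1) *: J.
Proof.
by rewrite /zero_idem; apply/matrixP => i j; rewrite !mxE; field; rewrite m_neq0.
Qed.

Lemma zero_rel_sym : ssrbool.symmetric zero_rel.
Proof. by move=> x y; rewrite /zero_rel quadBC. Qed.

Lemma relmx_zero_relJ :
  relmx zero_rel *m J = ((m ^+ 2 + m) / k - m) *: J.
Proof.
have K0 : 0 \in K by case: K_divring => K1 KB _; rewrite -(subrr 1) KB.
have -> : (m ^+ 2 + m) / k - m = (level (fun x => tau (Q x)) 0)%:R.
  by rewrite level_tau // eqxx mulr1.
apply/matrixP => i j; rewrite !mxE mulr1 level_sum natr_sum.
rewrite (reindex _ (onW_bij _ (@enum_rank_bij V))) /=.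
rewrite [RHS](reindex (fun z => enum_val i - z)) /=; last first.
  by exists (fun z => enum_val i - z) => z _; rewrite subKr.
by apply: eq_bigr => z _; rewrite !mxE enum_rankK mulr1.
Qed.

(** The entries are the numbers [count_both_zeroE]; off the diagonal the sum
    there has [k - 2] equal terms, because [tau (Q x)] takes every nonzero value
    equally often. *)
Lemma relmx_zero_rel_sqr :
  relmx zero_rel *m relmx zero_rel
  = k^-1 *: ((m ^+ 2 / k - m) *: J + (m ^+ 2 - m ^+ 2 / k) *: 1%:M
             - (m * (k - 2)) *: relmx zero_rel).
Proof.
have [K1 KB Kdiv] := K_divring.
have K0 : 0 \in K by rewrite -(subrr 1) KB.
have KN a : a \in K -> - a \in K by move=> aK; rewrite -sub0r KB.
have KD a b : a \in K -> b \in K -> a + b \in K.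
  by move=> aK bK; rewrite -[b]opprK KB ?KN.
have KM a b : a \in K -> b \in K -> a * b \in K.
  by move=> aK bK; rewrite -[b]invrK -[b^-1]mul1r Kdiv ?Kdiv.
apply: relmxP => x y; rewrite relmx_mulE -relmx_eq !mxE !enum_rankK mulr1.
set w := x - y; set T := fun z => tau (Q z).
have -> : #|[set z | zero_rel x z && zero_rel z y]|
        = #|[set z | (T z == 0) && (T (w - z) == 0)]|.
  rewrite -[RHS](card_preimset _ (can_inj (subKr x))).
  apply: eq_card => z; rewrite !inE /w /T (_ : x - y - (x - z) = z - y) //.
  by rewrite opprB addrC addrA subrK.
apply: (mulfI k_neq0); rewrite mulrA mulfV // mul1r.
have [xy|xy] := eqVneq x y.
  rewrite (_ : [set z | _] = [set z | T z == 0]); last first.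
    apply/setP => z; rewrite !inE /w xy subrr sub0r /T quadN //.
    by rewrite andbb.
  have -> : #|[set z | T z == 0]| = level T 0 by [].
  rewrite level_tau // eqxx.
  rewrite /zero_rel xy subrr quad0 // (_ : tau 0 == 0); last first.
    by rewrite -(inj_eq (addrI (tau 0))) -{1}[tau 0]mul1r -tau_lin // mulr0 !addr0.
  by rewrite !mulr1; field.
have w0 : w != 0 by rewrite subr_eq0.
rewrite (count_both_zeroE hQ K_divring tau_lin tauK tau_onto (polarQ w0)).
rewrite (eq_bigr (fun=> (m ^+ 2 + m) / k - m * (T w == 0)%:R)) => [|s]; last first.
  rewrite !inE => /and3P[sN1 s0 sK].
  have s1 : 1 + s != 0 by rewrite addrC -[1]opprK subr_eq0.
  have cK : - (s / (1 + s) ^+ 2) \in K by rewrite KN // Kdiv // expr2 KM ?KD.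
  rewrite level_tau ?KM ?tauK // mulf_eq0 oppr_eq0 mulf_eq0 invr_eq0 expf_eq0.
  by rewrite (negbTE s0) (negbTE s1).
rewrite sumr_const -[X in _ + X = _]mulr_natl level_tau // eqxx cardV.
set c := (X in _ + X * (_ - _)); have -> : c = k - 2.
  rewrite /c (cardsD1 0 K) (cardsD1 (-1) (K :\ 0)) K0 !inE oppr_eq0 oner_eq0 KN //.
  by rewrite !natrD addrA [RHS]addrC; apply: esym; apply: (addKr (2 : rat)).
by rewrite /zero_rel -/w -/(T w) !mulr1 mulr0; field.
Qed.

Let JJ : J *m J = m ^+ 2 *: J.
Proof.
apply/matrixP => i j; rewrite !mxE (eq_bigr (fun=> 1)) => [|z _].
  by rewrite sumr_const card_ord mulr1 -cardV.
by rewrite !mxE mulr1.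
Qed.

Lemma zero_idemJ : zero_idem *m J = 0.
Proof.
rewrite /zero_idem mulmxDl mulmxBl -!scalemxAl mul1mx JJ relmx_zero_relJ.
by apply/matrixP => i j; rewrite !mxE; field; rewrite m_neq0.
Qed.

Lemma zero_idem_sym : zero_idem^T = zero_idem.
Proof.
rewrite /zero_idem linearD linearB /= !linearZ /= trmx1 trmx_const.
by rewrite relmx_sym //; apply: zero_rel_sym.
Qed.

Lemma zero_idem_sym_idem : sym_idem zero_idem.
Proof.
split; first exact: zero_idem_sym.
rewrite {2}/zero_idem mulmxDr mulmxBr -!scalemxAr zero_idemJ mulmx1.
have JA : J *m relmx zero_rel = ((m ^+ 2 + m) / k - m) *: J.
  apply: trmx_inj; rewrite trmx_mul linearZ /= trmx_const relmx_sym.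
    exact: relmx_zero_relJ.
  exact: zero_rel_sym.
rewrite {2}/zero_idem mulmxDl mulmxBl -!scalemxAl mul1mx JA relmx_zero_rel_sqr.
by rewrite /zero_idem; apply/matrixP => i j; rewrite !mxE; field; rewrite m_neq0.
Qed.

End ZeroRelation.

(** * The trace map *)

Section Trace.

Variables (F : finFieldType) (q : nat) (g : F).
Hypothesis hq : prime_power q.
Hypothesis hF : #|F| = (q ^ 2)%N.
Hypothesis hg : #|F|.-1.-primitive_root g.
Local Notation tr := (trace_to_Fq q : F -> F).

Lemma prime_power_gt1 : (1 < q)%N.
Proof. by case: hq => p [n [p_pr n0 ->]]; rewrite -(expn0 p) ltn_exp2l ?prime_gt1. Qed.

Let q_gt0 : (0 < q)%N := ltnW prime_power_gt1.

Lemma frobD (x y : F) : (x + y) ^+ q = x ^+ q + y ^+ q.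
Proof.
case: hq => p [n [p_pr n0 qE]]; apply: exprDn_pchar.
have charp : p \in [pchar F].
  by apply: (@card_finPcharP _ _ (n * 2)) => //; rewrite hF qE expnM.
by rewrite qE pnatX (pnatE _ p_pr) charp.
Qed.

Lemma frobN (x : F) : (- x) ^+ q = - x ^+ q.
Proof.
by apply/eqP; rewrite -addr_eq0 -frobD addNr expr0n gtn_eqF.
Qed.

Definition fixed_Fq : {set F} := [set x | x ^+ q == x].

Lemma fixed_Fq_divring : divring_closed fixed_Fq.
Proof.
split=> [|x y|x y]; rewrite !inE ?expr1n // => /eqP xK /eqP yK.
  by rewrite frobD frobN xK yK.
by rewrite exprMn exprVn xK yK.
Qed.

Lemma traceD : {morph tr : x y / x + y}.
Proof. by move=> x y; rewrite /trace_to_Fq frobD addrACA. Qed.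

Lemma trace_lin a x y : a \in fixed_Fq -> tr (a * x + y) = a * tr x + tr y.
Proof.
rewrite inE traceD => /eqP aK; congr (_ + _).
by rewrite /trace_to_Fq exprMn aK mulrDr.
Qed.

Lemma trace_fixed x : tr x \in fixed_Fq.
Proof.
by rewrite inE /trace_to_Fq frobD -exprM mulnn -hF expf_card addrC.
Qed.

(** Roots of ['X^q - c *: 'X]; the subfield is the case [c = 1] and the kernel of
    the trace the case [c = -1]. *)
Lemma card_frob_eigen_le (c : F) : (#|[set x : F | (x ^+ q == c * x)%R]| <= q)%N.
Proof.
have sz : size ('X^q - c *: 'X : {poly F}) = q.+1.
  rewrite size_polyDl size_polyXn // size_polyN ltnS.
  by rewrite (leq_trans (size_scale_leq _ _)) // size_polyX prime_power_gt1.
rewrite cardE -ltnS -sz; apply: max_poly_roots.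
- by rewrite -size_poly_eq0 sz.
- apply/allP => x; rewrite mem_enum inE rootE !hornerE => /eqP ->.
  by rewrite subrr.
- exact: enum_uniq.
Qed.

(** A nonempty level is a translate of the kernel. *)
Lemma level_trace_le a : (level tr a <= q)%N.
Proof.
have [->|/card_gt0P[x]] := posnP (level tr a); first exact: ltnW q_gt0.
rewrite inE => /eqP trx; apply: leq_trans (card_frob_eigen_le (-1)).
rewrite /level -(card_imset _ (addrI (- x))); apply/subset_leq_card/subsetP => z.
case/imsetP => y; rewrite inE => /eqP ty ->; rewrite inE.
rewrite mulN1r -addr_eq0 addrC -[X in X == 0]/(tr (- x + y)) traceD ty.
by rewrite /trace_to_Fq frobN -opprD -/(tr x) trx addNr.
Qed.

(** The kernel of the trace and the subfield [fixed_Fq] both have at most [q]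
    elements, which [q ^ 2 = #|F|] forces to be sharp. *)
Lemma trace_counts :
  #|fixed_Fq| = q /\ forall a, a \in fixed_Fq -> level tr a = q.
Proof.
have K_le : (#|fixed_Fq| <= q)%N.
  by apply: leq_trans (card_frob_eigen_le 1); apply/eq_leq/eq_card => x;
    rewrite !inE mul1r.
have [tot_le tot_eq] := leqif_sum (fun a (_ : a \in fixed_Fq) =>
  leqif_eq (level_trace_le a)).
move: tot_le tot_eq; rewrite (sum_level trace_fixed) sum_nat_const hF.
rewrite leq_pmul2r // => q_le; have Kq : #|fixed_Fq| = q.
  by apply/eqP; rewrite eqn_leq K_le.
split=> // a aK; move: tot_eq; rewrite Kq mulnn eqxx => /esym/forall_inP/(_ a aK).
by move/eqP.
Qed.

Lemma trace_onto b : b \in fixed_Fq -> exists x, tr x = b.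
Proof.
move=> /trace_counts.2 lb; have : (0 < level tr b)%N by rewrite lb.
by case/card_gt0P => x; rewrite inE => /eqP; exists x.
Qed.

Lemma prim_neq0 : g != 0.
Proof.
apply: contra_eqN (prim_expr_order hg) => /eqP ->.
by rewrite expr0n (gtn_eqF (prim_order_gt0 hg)) eq_sym oner_eq0.
Qed.

Lemma prim_gen (c : F) : c != 0 -> exists j, c = g ^+ j.
Proof.
move=> c0; have c1 : c ^+ #|F|.-1 = 1.
  apply: (mulfI c0); rewrite -exprS prednK ?expf_card ?mulr1 //.
  by rewrite hF expn_gt0 q_gt0.
by have [j ->] := prim_rootP hg c1; exists j.
Qed.

(** Nonzero [y] has trace zero exactly when [y ^+ (q - 1) = -1], so these [y]
    form one coset of the group generated by [g ^+ (q + 1)]. *)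
Lemma trace_gen : exists h, forall j, (tr (g ^+ j) == 0) = (j == h %[mod q.+1]).
Proof.
have [y [y0 ty]] : exists y : F, y != 0 /\ tr y = 0.
  have K0 : 0 \in fixed_Fq by rewrite inE expr0n gtn_eqF.
  have := trace_counts.2 0 K0; rewrite /level (cardsD1 0) => card_ker.
  have : (0 < #|[set x | (tr x == 0)%R] :\ 0%R|)%N.
    have := prime_power_gt1; rewrite -[X in (_ < X)%N]card_ker.
    by case: (0 \in _) => //; apply: ltnW.
  case/card_gt0P => y; rewrite !inE => /andP[y0 /eqP ty].
  by exists y.
have [h yE] := prim_gen y0; exists h => j.
have trE z : z != 0 -> (tr z == 0) = (z ^+ q.-1 == -1).
  move=> z0; rewrite /trace_to_Fq -{1}(prednK q_gt0) exprS -{1}[z]mulr1 -mulrDr.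
  by rewrite mulf_eq0 (negbTE z0) /= addrC addr_eq0.
have g0 := prim_neq0.
rewrite trE ?expf_neq0 //; move/eqP: ty; rewrite trE // yE => /eqP <-.
rewrite -!exprM (eq_prim_root_expr hg).
have -> : #|F|.-1 = (q.+1 * q.-1)%N.
  by rewrite hF -subn1 -[1%N](exp1n 2) subn_sqr mulnC addn1 subn1.
by rewrite -!muln_modl eqn_pmul2r // -subn1 subn_gt0 prime_power_gt1.
Qed.

Lemma trace_gen_unique (c : F) : c != 0 ->
  exists i : 'I_q.+1, forall i' : 'I_q.+1, (tr (g ^+ i' * c) == 0) = (i' == i).
Proof.
move=> /prim_gen[j ->]; have [h trE] := trace_gen.
(* The witness is [h - j]: modulo [q + 1], [q * j] is [- j]. *)
exists (Ordinal (ltn_pmod (h + q * j) (ltn0Sn q))) => i'.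
rewrite -exprD trE -[RHS]val_eqE /=.
rewrite -(eqn_modDr (q * j)) -addnA -mulSn -modnDmr modnMr addn0 modn_small //.
Qed.

End Trace.

(** * Elliptic forms over the field with [q ^ 2] elements *)

Lemma level_comp (U R S : finType) (Q : U -> R) (f : R -> S) a :
  level (f \o Q) a = (\sum_(b | f b == a) level Q b)%N.
Proof.
rewrite level_sum (eq_bigr _ (fun b _ => level_sum Q b)) exchange_big /=.
apply: eq_bigr => x _; case: eqP => [fa|fa].
  rewrite (bigD1 (Q x)) ?fa //= eqxx big1 ?addn0 // => b /andP[_ bQ].
  by rewrite eq_sym (negbTE bQ).
rewrite big1 // => b /eqP fb; apply/eqP; rewrite eqb0.
by apply: contra_not_neq fa => ->.
Qed.

Lemma elliptic_level (F : finFieldType) l (Q : 'rV[F]_(2 * l) -> F) a :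
  (0 < l)%N -> elliptic Q ->
  (level Q a)%:R = ((#|F|%:R ^+ l) ^+ 2 + #|F|%:R ^+ l) / #|F|%:R
                   - #|F|%:R ^+ l * (a == 0)%:R :> rat.
Proof.
case: l Q => // l Q _ [p [A [p_homog p_irr A_unit QE]]].
rewrite -(elliptic_model_level p_homog p_irr); congr _%:R.
apply: (@level_bij _ _ _ _ (mulmx^~ A)) => [|x]; last by rewrite QE.
by exists (mulmx^~ (invmx A)) => x; rewrite -mulmxA ?mulmxV ?mulVmx // mulmx1.
Qed.

(** A vector in the radical of the polar form is either singular, against
    nonsingularity, or makes all levels of [Q] equal. *)
Lemma nonsingular_polar (F : finFieldType) n (Q : 'rV[F]_n -> F) :
  quadratic_form Q -> nonsingular Q -> level Q 0 <> level Q 1 ->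
  forall w, w != 0 -> exists z, polar Q w z != 0.
Proof.
move=> hQ hns l01 w w0; apply/existsP; apply: contraNT w0 => /existsPn w_rad.
have {}w_rad z : polar Q w z = 0 by apply/eqP/negPn/w_rad.
have Qw0 : Q w = 0.
  apply/eqP/negPn/negP => Qw0; apply: l01.
  have lE := level_polar_radical hQ w_rad Qw0.
  by apply/eqP; rewrite -(eqn_pmul2l (ltnW (card_field_gt1 F))) !lE.
have /vspaceP/(_ w) : <[w]>%VS = 0%VS.
  apply: hns => _ /vlineP[c ->]; split=> [|v]; first by rewrite quadZ // Qw0 mulr0.
  by rewrite polarC -[c *: w]addr0 polarZDr // polar0r // polarC w_rad mulr0 addr0.
by rewrite memv_line memv0 => <-.
Qed.

Section Assembly.

Variables (q l : nat) (F : finFieldType) (g : F) (Q : 'rV[F]_(2 * l) -> F).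
Hypothesis hq : prime_power q.
Hypothesis hl : (0 < l)%N.
Hypothesis hF : #|F| = (q ^ 2)%N.
Hypothesis hg : #|F|.-1.-primitive_root g.
Hypothesis hQ : quadratic_form Q.
Hypothesis hns : nonsingular Q.
Hypothesis hell : elliptic Q.

Local Notation V := 'rV[F]_(2 * l).
Local Notation J := (const_mx 1 : 'M[rat]_#|V|).
Let m : rat := #|F|%:R ^+ l.
Let K := fixed_Fq F q.
Let tau (i : nat) (a : F) : F := trace_to_Fq q (g ^+ i * a).

Let m_neq0 : m != 0.
Proof. by rewrite expf_neq0 // card_field_neq0. Qed.

Let q_neq0 : q%:R != 0 :> rat.
Proof. by rewrite pnatr_eq0 -lt0n ltnW // prime_power_gt1. Qed.

Let cardFE : #|F|%:R = q%:R ^+ 2 :> rat.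
Proof. by rewrite hF natrX. Qed.

Let cardV : #|{: V}|%:R = m ^+ 2.
Proof. by rewrite card_mx mul1n natrX mulnC exprM. Qed.

Let levelQ a := elliptic_level a hl hell.

Let polarQ w : w != 0 -> exists z, polar Q w z != 0.
Proof.
apply: nonsingular_polar => // /(congr1 (fun k => k%:R : rat)).
rewrite !levelQ eqxx oner_eq0 mulr0 => /addrI/eqP.
by rewrite eqr_opp mulr1 (negbTE m_neq0).
Qed.

Let cardK : #|K| = q := (trace_counts hq hF).1.

Let level_tau_fib i a : a \in K -> level (tau i) a = q.
Proof.
move=> aK; rewrite -((trace_counts hq hF).2 a aK).
apply: (@level_bij _ _ _ _ ( *%R (g ^+ i))) => // .
have gi : g ^+ i != 0 by rewrite expf_neq0 // (prim_neq0 hg).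
by exists ( *%R (g ^+ i)^-1) => x; [apply: mulKf | apply: mulVKf].
Qed.

Let tau_lin i a x y : a \in K -> tau i (a * x + y) = a * tau i x + tau i y.
Proof. by move=> aK; rewrite /tau mulrDr mulrCA trace_lin. Qed.

Let tauK i x : tau i x \in K. Proof. exact: trace_fixed. Qed.

Let tau_onto i b : b \in K -> exists x, tau i x = b.
Proof.
move=> /(trace_onto hq hF)[x <-]; exists ((g ^+ i)^-1 * x).
by rewrite /tau mulVKf // expf_neq0 // (prim_neq0 hg).
Qed.

Let tau0 i : tau i 0 = 0.
Proof.
rewrite /tau mulr0 /trace_to_Fq expr0n gtn_eqF ?addr0 // ltnW //.
exact: prime_power_gt1.
Qed.

(** The form [tau i \o Q] over the subfield has the level sizes of an elliptic
    form in twice as many variables over a field of size [q]. *)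
Let level_tauQ i a : a \in K ->
  (level (fun x => tau i (Q x)) a)%:R = (m ^+ 2 + m) / #|K|%:R - m * (a == 0)%:R.
Proof.
move=> aK; rewrite -[level _ _]/(level (tau i \o Q) a) level_comp natr_sum.
rewrite (eq_bigr _ (fun b _ => levelQ b)) sumrB sumr_const -mulr_sumr.
rewrite (_ : #|_| = q); last first.
  by rewrite -(level_tau_fib i aK); apply: eq_card => b; rewrite !inE.
rewrite -/m cardK cardFE (_ : \sum_(b | _) _ = (a == 0)%:R).
  by rewrite -[_ *+ q]mulr_natr; field.
have [->|a0] := eqVneq a 0.
  rewrite (bigD1 0) ?tau0 //= eqxx big1 ?addr0 // => b /andP[_ /negbTE ->].
  by [].
apply: big1 => b /eqP tb; apply/eqP; rewrite pnatr_eq0 eqb0.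
by apply: contraNneq a0 => b0; rewrite -tb b0 tau0.
Qed.

Let Krel i := zero_rel Q (tau i).
Let Frel := zero_rel Q id.
Let f (i : 'I_q.+1) := zero_idem Q K (tau i) m.
Let e := zero_idem Q setT id m.

Let setT_divring : divring_closed [set: F].
Proof. by split=> [|x y _ _|x y _ _]; rewrite inE. Qed.

Let levelQT a : a \in [set: F] ->
  (level (fun x => id (Q x)) a)%:R
  = (m ^+ 2 + m) / #|[set: F]|%:R - m * (a == 0)%:R.
Proof. by rewrite cardsT => _; apply: levelQ. Qed.

Let K_divring := fixed_Fq_divring hq hF.

Let f_sym_idem i : sym_idem (f i).
Proof.
apply: zero_idem_sym_idem => //; [exact: tau_lin | exact: tau_onto | exact: level_tauQ].
Qed.

Let e_sym_idem : sym_idem e.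
Proof. by apply: zero_idem_sym_idem => // b _; exists b. Qed.

Let fJ i : f i *m J = 0.
Proof. by apply: zero_idemJ => //; apply: level_tauQ. Qed.

Let eJ : e *m J = 0.
Proof. by apply: zero_idemJ. Qed.

Let trace_zero x : x != 0 -> exists i : 'I_q.+1,
  forall i' : 'I_q.+1, (tau i' x == 0) = (i' == i).
Proof. exact: trace_gen_unique. Qed.

(** A pair with [Q (x - y) = 0] lies in all [q + 1] relations [Krel i], any other
    pair in exactly one of them. *)
Let sum_f : \sum_i f i = 1%:M - m ^- 2 *: J + q%:R *: e.
Proof.
have sum_rel : \sum_(i < q.+1) relmx (Krel i) = J + q%:R *: relmx Frel.
  apply: relmxP => x y; rewrite summxE.
  rewrite (eq_bigr (fun i : 'I_q.+1 => (tau i (Q (x - y)) == 0)%:R)); last first.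
    by move=> i _; rewrite relmxE.
  rewrite [RHS]mxE [X in _ = X + _]mxE [X in _ = _ + X]mxE relmxE /Frel /zero_rel.
  have [->|/trace_zero[i iP]] := eqVneq (Q (x - y)) 0.
    rewrite (eq_bigr (fun=> 1)) => [|i _]; last by rewrite tau0 eqxx.
    by rewrite sumr_const card_ord mulr1 -natr1 addrC.
  rewrite (bigD1 i) //= iP eqxx big1 ?mulr0 // => j /negbTE ji.
  by rewrite iP ji.
rewrite /f /zero_idem big_split sumrB /= !sumr_const card_ord -scaler_sumr sum_rel.
rewrite /e /zero_idem cardK cardsT cardFE -/Frel.
rewrite -!scaler_nat.
apply/matrixP => i j; rewrite !mxE -natr1; field.
by rewrite m_neq0 q_neq0.
Qed.

Let P (k : 'I_q.+2) := if unlift ord0 k is Some i then f i - e else e.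

Let P_orth i j : P i *m P j = if i == j then P i else 0.
Proof.
apply: (sym_idem_sunflower e_sym_idem f_sym_idem sum_f) => [|k].
  by rewrite -scalemxAr eJ scaler0.
by rewrite -scalemxAr fJ scaler0.
Qed.

Let PJ k : P k *m J = 0.
Proof. by rewrite /P; case: unlift => [i|]; rewrite ?mulmxBl ?fJ ?eJ ?subrr. Qed.

Let JP k : J *m P k = 0.
Proof.
apply: trmx_inj; rewrite trmx_mul trmx0 trmx_const -(PJ k); congr (_ *m _).
rewrite /P; case: unlift => [i|]; last exact: e_sym_idem.1.
by rewrite linearB /= (f_sym_idem i).1 e_sym_idem.1.
Qed.

Let E (k : 'I_q.+2) : rel V := cayley (Omega_class g Q k).

Lemma Omega_classE (k : 'I_q.+2) x : (x \in Omega_class g Q k) = (x != 0) &&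
  if unlift ord0 k is Some i then (Q x != 0) && (tau i (Q x) == 0) else Q x == 0.
Proof.
rewrite /Omega_class; case: unlift => [i|]; rewrite !inE //.
by case: (x != 0) => //=; rewrite andbT.
Qed.

Let E_sym k : ssrbool.symmetric (E k).
Proof.
move=> x y; rewrite /E /cayley !Omega_classE -oppr_eq0 opprB.
by rewrite (quadBC hQ x y).
Qed.

Let E_irr k : irreflexive (E k).
Proof. by move=> x; rewrite /E /cayley subrr Omega_classE eqxx. Qed.

Let E_cover x y : x != y -> exists k, E k x y.
Proof.
rewrite -subr_eq0 => xy; have [Q0|Q0] := eqVneq (Q (x - y)) 0.
  by exists ord0; rewrite /E /cayley Omega_classE unlift_none xy Q0 eqxx.
have [i iP] := trace_zero Q0; exists (lift ord0 i).
by rewrite /E /cayley Omega_classE liftK xy Q0 iP eqxx.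
Qed.

Let E_disj j k x y : E j x y -> E k x y -> j = k.
Proof.
rewrite /E /cayley !Omega_classE => /andP[_ ej] /andP[_ ek]; move: ej ek.
case: (unliftP ord0 j) => [j'|] ->; case: (unliftP ord0 k) => [k'|] -> //.
- move=> /andP[Q0 tj] /andP[_ tk]; have [i iP] := trace_zero Q0.
  by move: tj tk; rewrite !iP => /eqP -> /eqP ->.
- by move=> /andP[/negbTE ->].
- by move=> /eqP ->; rewrite eqxx.
Qed.

Let relE k : exists a b : rat, relmx (E k) = - m *: P k + a *: 1%:M + b *: J.
Proof.
have FE : relmx Frel = - m *: e + (m / #|[set: F]|%:R) *: 1%:M
                       + (#|[set: F]|%:R^-1 - m^-1) *: J.
  by apply: relmx_zero_rel.
have relE0 : relmx (E ord0) = relmx Frel - 1%:M.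
  rewrite -relmx_eq; apply: relmxP => x y; rewrite [RHS]mxE [X in _ + X]mxE !relmxE.
  rewrite /E /cayley Omega_classE unlift_none /Frel /zero_rel subr_eq0.
  have [->|_] := eqVneq x y; first by rewrite subrr quad0 // eqxx subrr.
  by rewrite subr0.
rewrite /P; case: (unliftP ord0 k) => [i|] ->; last first.
  exists (m / #|[set: F]|%:R - 1), (#|[set: F]|%:R^-1 - m^-1).
  by rewrite relE0 FE; apply/matrixP => a b; rewrite !mxE; ring.
have KE : relmx (Krel i) = - m *: f i + (m / #|K|%:R) *: 1%:M
                           + (#|K|%:R^-1 - m^-1) *: J.
  by apply: relmx_zero_rel.
have relEi : relmx (E (lift ord0 i)) = relmx (Krel i) - relmx Frel.
  apply: relmxP => x y; rewrite [RHS]mxE [X in _ + X]mxE !relmxE.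
  rewrite /E /cayley Omega_classE liftK /Krel /Frel /zero_rel subr_eq0.
  have [->|_] := eqVneq x y; first by rewrite subrr quad0 // tau0 eqxx subrr.
  by have [->|_] := eqVneq (Q (x - y)) 0; rewrite ?tau0 ?eqxx ?subrr ?subr0.
exists (m / #|K|%:R - m / #|[set: F]|%:R), (#|K|%:R^-1 - #|[set: F]|%:R^-1).
by rewrite relEi KE FE; apply/matrixP => a b; rewrite !mxE; ring.
Qed.

Let exists_coefs : exists a b : 'I_q.+2 -> rat,
  forall k, relmx (E k) = - m *: P k + a k *: 1%:M + b k *: J.
Proof.
have /fin_all_exists[a aE] := relE.
by have /fin_all_exists[b abE] := aE; exists a, b.
Qed.

Lemma Omega_strongly_regular k :
  exists v kk lam mu, strongly_regular (E k) v kk lam mu.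
Proof.
have [a [b abE]] := exists_coefs.
apply: (strongly_regular_orthogonal E_sym E_irr E_disj abE P_orth PJ JP).
by apply/card_gt0P; exists 0.
Qed.

Lemma Omega_amorphic : amorphic (graph_relations E).
Proof.
have [a [b abE]] := exists_coefs.
exact: (amorphic_orthogonal E_sym E_irr E_cover E_disj abE P_orth PJ JP).
Qed.

End Assembly.

Theorem theorem4p4 (q l : nat) (F : finFieldType) (g : F)
    (Q : 'rV[F]_(2 * l) -> F)
    (hq : prime_power q) (hl : (0 < l)%N) (hF : #|F| = (q ^ 2)%N)
    (hg : #|F|.-1.-primitive_root g)
    (hQ : quadratic_form Q) (hns : nonsingular Q) (hell : elliptic Q) :
  (forall k : 'I_q.+2, exists v kk lam mu : nat,
     partial_difference_set (Omega_class g Q k) v kk lam mu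
     /\ strongly_regular (cayley (Omega_class g Q k)) v kk lam mu)
  /\ amorphic (graph_relations (fun k : 'I_q.+2 => cayley (Omega_class g Q k))).
Proof.
split=> [k|]; last exact: Omega_amorphic.
have [v [kk [lam [mu srg]]]] := Omega_strongly_regular hq hl hF hg hQ hns hell k.
by exists v, kk, lam, mu; split=> //; apply: partial_difference_set_cayley.
Qed.
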